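(* Let $p$ be a prime, let $K \ge 1$, $n \ge 1$ and $j$ be integers with $0 \le j \le n-1$ and $p^{n-j} \ge Kp^{j}$ (equivalently, $2(n-j) \ge \log_p(K)+n$), and let $N = Kp^n+1$. Assume that there exist integers $a>1$ and $L$ such that: (i) $a^{Kp^{n-j-1}} \equiv L \pmod N$ and $L \not\equiv 1 \pmod N$, and (ii) $L^{p^{j+1}} \equiv 1 \pmod N$. Then $N$ is prime. *)

(* Defs.v *)
From mathcomp Require Export all_boot all_order all_algebra.

(* Main.v *)
Require Import Defs.
From mathcomp Require Import all_boot all_order all_algebra all_field.
From mathcomp Require Import zify.

Set Implicit Arguments.
Unset Strict Implicit.
Unset Printing Implicit Defensive.

Import Order.TTheory GRing.Theory Num.Theory.

(** The idea is to find one prime factor [q] of [N] with [q = 1 mod p^(n-j)].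
    Since [N] divides [L^(p^(j+1)) - 1] but not [L - 1], and since the second
    factor in [L^m - 1 = (L - 1)(1 + L + ... + L^(m-1))] is [m] modulo [L - 1],
    some prime [q] dividing [N] does not divide [L - 1]. If [p^(n-j)] did not
    divide [q - 1], the order of [a] modulo [q], which divides [q - 1] and
    [K p^n], would divide [K p^(n-j-1)], making [L = 1 mod q]. The cofactor of
    [q] in [N] is then also [1 mod p^(n-j)], so unless it is [1] we get
    [N >= (1 + p^(n-j))^2 > 1 + K p^n]. *)

Lemma intr_Fp_eq0 (q : nat) (z : int) :
  prime q -> ((z%:~R : 'F_q) == 0)%R = (q %| z)%Z.
Proof. by move=> q_pr; rewrite -(dvdz_pcharf (pchar_Fp q_pr) z). Qed.

(** Any prime factor [q] of [N / gcd(N, L - 1)] works: this quotient divides the geometric sum [S],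
    so if [q] also divided [L - 1], it would divide [m]. *)
Lemma prime_dvd_expz_sub1 (N m : nat) (L : int) :
    (0 < N)%N -> coprime N m ->
    (N %| (L ^+ m - 1)%R)%Z -> ~~ (N %| (L - 1)%R)%Z ->
  exists q : nat, [/\ prime q, (q %| N)%N & ~~ (q %| (L - 1)%R)%Z].
Proof.
move=> N_gt0 coNm; rewrite subrX1; set S := (\sum_(i < m) _)%R => dvdN ndvdN.
set g := gcdn N `|(L - 1)%R|%N.
have gN : (g %| N)%N by apply: dvdn_gcdl.
have g_gt0 : (0 < g)%N by rewrite gcdn_gt0 N_gt0.
have h_gt1 : (1 < N %/ g)%N.
  rewrite ltn_divRL // mul1n ltn_neqAle dvdn_leq // andbT.
  by apply: contra ndvdN => /eqP gE; rewrite dvdzE absz_nat -gE dvdn_gcdr.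
have q_pr := pdiv_prime h_gt1; set q := pdiv _ in q_pr.
have qh : (q %| N %/ g)%N by apply: pdiv_dvd.
have qN : (q %| N)%N by apply: dvdn_trans qh _; apply: dvdn_div.
exists q; split=> //; apply/negP => qL.
have qS : (q %| S)%Z.
  rewrite dvdzE; apply: dvdn_trans qh _.
  have co : coprime (N %/ g) (`|(L - 1)%R|%N %/ g).
    rewrite /coprime -(eqn_pmul2r g_gt0) muln_gcdl !divnK ?dvdn_gcdr //.
    by rewrite mul1n.
  rewrite -(Gauss_dvdr _ co) -(dvdn_pmul2r g_gt0) mulnAC !divnK ?dvdn_gcdr //.
  by rewrite -abszM -[X in (X %| _)%N]absz_nat -dvdzE.
(* Modulo [q] each of the [m] terms of [S] becomes [1], so [S = m]. *)
have L1 : (L%:~R = 1 :> 'F_q)%R.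
  by apply/eqP; rewrite -subr_eq0 -intr_Fp_eq0 // rmorphB in qL *.
have qm : (q %| m)%N.
  rewrite (dvdn_pcharf (pchar_Fp q_pr)).
  move: qS; rewrite -intr_Fp_eq0 // rmorph_sum /=.
  under eq_bigr do rewrite rmorphXn /= L1 expr1n.
  by rewrite sumr_const card_ord.
have := prime_gt1 q_pr.
by rewrite -(eqP coNm) ltnNge dvdn_leq ?gcdn_gt0 ?N_gt0 ?dvdn_gcd ?qN.
Qed.

(** The order of [x] divides both [K * p ^ n] and [#|F|.-1], hence [K * gcdn #|F|.-1 (p ^ n)]; this
    gcd is some [p ^ e] with [e <= i]. *)
Lemma expr_ppow_eq1 (F : finFieldType) (x : F) (p K n i : nat) :
    prime p -> (0 < K)%N -> (i < n)%N ->
    (x ^+ (K * p ^ n)%N = 1)%R -> ~~ (p ^ i.+1 %| #|F|.-1)%N ->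
  (x ^+ (K * p ^ i)%N = 1)%R.
Proof.
move=> p_pr K_gt0 lt_in xKn ndvd.
have Kpn_gt0 : (0 < K * p ^ n)%N by rewrite muln_gt0 K_gt0 expn_gt0 prime_gt0.
have x_neq0 : (x != 0)%R.
  by apply: contra_eq_neq xKn => ->; rewrite expr0n gtn_eqF // eq_sym oner_eq0.
have xq : (x ^+ #|F|.-1 = 1)%R.
  apply: (mulfI x_neq0); rewrite -exprS mulr1 prednK ?expf_card //.
  by apply/card_gt0P; exists x.
have [k k_prim kKpn] := prim_order_exists Kpn_gt0 xKn.
have kq : (k %| #|F|.-1)%N by rewrite (prim_order_dvd k_prim) xq.
apply/eqP; rewrite -(prim_order_dvd k_prim).
have [e _ gE] := dvdn_pfactor _ n p_pr (dvdn_gcdr #|F|.-1 (p ^ n)).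
have le_ei : (e <= i)%N.
  rewrite leqNgt; apply: contra ndvd => lt_ie.
  by apply: dvdn_trans (dvdn_gcdl _ (p ^ n)%N); rewrite gE dvdn_exp2l.
apply: (@dvdn_trans (K * p ^ e)%N); last by rewrite dvdn_pmul2l // dvdn_exp2l.
by rewrite -gE muln_gcdr dvdn_gcd kKpn dvdn_mull.
Qed.

Lemma prime_of_large_prime_factor (N P q : nat) :
    (0 < P)%N -> prime q -> (q %| N)%N -> (P %| q.-1)%N -> (P %| N.-1)%N ->
    (0 < N <= P ^ 2 + 1)%N ->
  prime N.
Proof.
move=> P_gt0 q_pr /dvdnP[r ->] /dvdnP[c cE] PN /andP[N_gt0 leN].
have qE : q = (c * P).+1 by rewrite -cE prednK ?prime_gt0.
have c_gt0 : (0 < c)%N by have := prime_gt1 q_pr; rewrite qE; case: c {cE qE}.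
have r_gt0 : (0 < r)%N by move: N_gt0; rewrite muln_gt0 => /andP[].
(* Since [q = 1] modulo [P], the cofactor [r] is congruent to [N], that is to [1]. *)
have /dvdnP[d dE] : (P %| r.-1)%N.
  have NE : ((r * q).-1 = r * c * P + r.-1)%N by rewrite qE; lia.
  by move: PN; rewrite NE dvdn_addr // dvdn_mull.
have rE : r = (d * P).+1 by rewrite -dE prednK.
(* Either [r = 1] and [N = q], or both factors are at least [P + 1], too large for the bound on
   [N]. *)
case: d {dE} rE => [->|d rE]; first by rewrite mul0n mul1n.
by move: leN; rewrite rE qE; nia.
Qed.

Theorem theorem2p5 (p K n j N : nat) (hp : prime p)
    (hK : (1 <= K)%N) (hn : (1 <= n)%N) (hj : (j <= n - 1)%N)
    (hpK : (K * p ^ j <= p ^ (n - j))%N)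
    (hN : N = (K * p ^ n + 1)%N)
    (haL : exists a L : int,
       [/\ (1 < a)%R,
           (a ^+ (K * p ^ (n - j - 1))%N = L %[mod N%:Z])%Z,
           (L <> 1 %[mod N%:Z])%Z
         & (L ^+ (p ^ (j + 1))%N = 1 %[mod N%:Z])%Z]) :
  prime N.
Proof.
case: haL => a [L [_ /eqP aL /eqP L_neq1 /eqP Lp]].
rewrite !eqz_mod_dvd in aL L_neq1 Lp.
have lt_jn : (j < n)%N by rewrite (leq_ltn_trans hj) // subn1 prednK.
have predS : (n - j - 1).+1 = (n - j)%N by rewrite subn1 prednK // subn_gt0.
have N_gt0 : (0 < N)%N by rewrite hN addn1.
(* As [n >= 1], [p] divides [N - 1]. *)
have coN : coprime N (p ^ (j + 1)).
  rewrite coprimeXr // hN -(prednK hn) expnSr mulnA.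
  by rewrite /coprime gcdnC gcdnMDl gcdn1.
have [q [q_pr qN qL]] := prime_dvd_expz_sub1 N_gt0 coN Lp L_neq1.
have toF (z : int) : (N %| z)%Z -> (z%:~R = 0 :> 'F_q)%R.
  by move=> Nz; apply/eqP; rewrite intr_Fp_eq0 //; apply: dvdz_trans Nz.
have aLF : ((a%:~R) ^+ (K * p ^ (n - j - 1))%N = L%:~R :> 'F_q)%R.
  by apply/eqP; rewrite -subr_eq0 -rmorphXn -rmorphB /= toF.
have LpF : ((L%:~R) ^+ (p ^ (j + 1))%N = 1 :> 'F_q)%R.
  apply/eqP; rewrite -subr_eq0 -rmorphXn.
  by rewrite -(rmorph1 (intr : int -> 'F_q)) -rmorphB /= toF.
apply: (@prime_of_large_prime_factor N (p ^ (n - j)) q) => //.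
- by rewrite expn_gt0 prime_gt0.
(* The order argument is applied with [i = n - j - 1], so that [L], a power of [a], would be [1] in
   ['F_q]. *)
- apply: contraR qL => ndvd.
  rewrite -intr_Fp_eq0 // rmorphB /= subr_eq0 -aLF; apply/eqP.
  apply: (@expr_ppow_eq1 _ _ p K n) => //.
  + by rewrite predS leq_subr.
  + have -> : (K * p ^ n = K * p ^ (n - j - 1) * p ^ (j + 1))%N.
      by rewrite -mulnA -expnD -subnDA subnK // addn1.
    by rewrite exprM aLF.
  + by rewrite predS card_Fp.
- by rewrite hN addn1 /= dvdn_mull // dvdn_exp2l // leq_subr.
(* The size hypothesis enters through [K p^n = p^(n-j) (K p^j)]. *)
- rewrite N_gt0 hN leq_add2r -{1}(subnK (ltnW lt_jn)) expnD mulnCA.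
  by rewrite -mulnn leq_mul2l hpK orbT.
Qed.
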